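(* Let $A\in\mathbb{R}^{m\times n}$ have nonzero rows and let $b\in\mathbb{R}^m$ be such that the linear system $Ax=b$ is consistent. Suppose the initial vector satisfies $x^0\in\operatorname{Range}(A^\top)$. Then $x^0_*:=A^\dagger b+(I-A^\dagger A)x^0$ equals $x^*_{LN}:=A^\dagger b$, and the sequence $\{x^k\}_{k\geq 0}$ generated from $x^0$ by the random reshuffling Kaczmarz (RRK) method converges (for every realization of the random permutations) to $x^*_{LN}$, the unique least-norm solution of $Ax=b$.
   Context: Notation: $[m]=\{1,\dots,m\}$; $A^\dagger$ is the Moore-Penrose pseudoinverse of $A$; $\|\cdot\|_2$ is the Euclidean norm; $a_i\in\mathbb{R}^n$ is the $i$-th row of $A$ written as a column vector, and $b_i$ is the $i$-th entry of $b$. The least-norm solution is the solution of $Ax=b$ of minimal Euclidean norm. RRK method: given $x^0\in\mathbb{R}^n$, for $k=0,1,2,\dots$ set $x^k_0:=x^k$, generate a random permutation $\pi_k=(\pi_{k,1},\dots,\pi_{k,m})$ of $[m]$, and for $i=1,\dots,m$ set $$x^k_i:=x^k_{i-1}-\frac{\langle a_{\pi_{k,i}},x^k_{i-1}\rangle-b_{\pi_{k,i}}}{\|a_{\pi_{k,i}}\|_2^2}\,a_{\pi_{k,i}};$$ then set $x^{k+1}:=x^k_m$. *)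

(* Defs.v *)
From HB Require Import structures.
From mathcomp Require Import all_boot all_order all_algebra all_fingroup.
From mathcomp Require Import all_classical all_reals all_analysis.

Set Implicit Arguments.
Unset Strict Implicit.
Unset Printing Implicit Defensive.

Import Order.TTheory GRing.Theory Num.Theory.
Import numFieldNormedType.Exports.

Local Open Scope classical_set_scope.
Local Open Scope ring_scope.

Definition dot (R : realType) (n : nat) (u v : 'cV[R]_n) : R :=
  \sum_(j < n) u j 0 * v j 0.

(* The library norm on matrices is the max norm, hence this definition. *)
Definition norm2 (R : realType) (n : nat) (u : 'cV[R]_n) : R :=
  Num.sqrt (dot u u).

(* The four Penrose equations. *)
Definition penrose (R : realType) (m n : nat)
    (A : 'M[R]_(m, n)) (X : 'M[R]_(n, m)) : Prop :=
  [/\ A *m X *m A = A, X *m A *m X = X,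
      (A *m X)^T = A *m X & (X *m A)^T = X *m A].

(* Not the library's [pinvmx], which need not satisfy the two symmetry
   equations. The default value 0 is a dummy: see [mpinvP] and [penrose_uniq]. *)
Definition mpinv (R : realType) (m n : nat) (A : 'M[R]_(m, n)) : 'M[R]_(n, m) :=
  xget 0 [set X | penrose A X].

Lemma mulmx_tr_eq0 (R : realType) (m n : nat) (A : 'M[R]_(m, n)) :
  A *m A^T = 0 -> A = 0.
Proof.
move=> A0; apply/matrixP => i j; rewrite mxE.
have /eqP : (A *m A^T) i i = 0 by rewrite A0 mxE.
rewrite mxE psumr_eq0 => [/allP /(_ j)|k _]; last by rewrite mxE -expr2 sqr_ge0.
by rewrite mem_index_enum mxE mulf_eq0 orbb => /(_ isT)/eqP.
Qed.

Lemma gram_unitmx (R : realType) (m n : nat) (F : 'M[R]_(m, n)) :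
  row_free F -> F *m F^T \in unitmx.
Proof.
move=> Ffree; rewrite -row_free_unit -kermx_eq0; apply/eqP.
set K := kermx _; apply: (row_free_inj Ffree); rewrite mul0mx.
apply: mulmx_tr_eq0.
by rewrite trmx_mul mulmxA -(mulmxA K) mulmx_ker mul0mx.
Qed.

Lemma penrose_rank_factorization (R : realType) (m r n : nat)
    (C : 'M[R]_(m, r)) (F : 'M[R]_(r, n)) :
  row_free C^T -> row_free F ->
  penrose (C *m F)
    (F^T *m invmx (F *m F^T) *m (invmx (C^T *m C) *m C^T)).
Proof.
move=> Cfree /gram_unitmx uF.
have uC : C^T *m C \in unitmx by rewrite -{2}(trmxK C); exact: gram_unitmx.
set G := invmx (F *m F^T); set H := invmx (C^T *m C).
have GT : G^T = G by rewrite /G trmx_inv trmx_mul trmxK.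
have HT : H^T = H by rewrite /H trmx_inv trmx_mul trmxK.
have FG : F *m F^T *m G = 1%:M by rewrite mulmxV.
have HC : H *m (C^T *m C) = 1%:M by rewrite mulVmx.
have GF : G *m (F *m F^T) = 1%:M by rewrite mulVmx.
set X := _ *m (H *m C^T).
have AX : C *m F *m X = C *m (H *m C^T).
  by rewrite /X -!mulmxA (mulmxA F) (mulmxA (F *m _)) FG mul1mx.
have XA : X *m (C *m F) = F^T *m (G *m F).
  by rewrite /X -!mulmxA (mulmxA C^T) (mulmxA H) HC mul1mx.
split.
- by rewrite AX -!mulmxA (mulmxA C^T) (mulmxA H) HC mul1mx.
- by rewrite XA /X -!mulmxA (mulmxA F F^T) (mulmxA G (F *m _)) GF mul1mx.
- by rewrite AX !trmx_mul trmxK HT mulmxA.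
- by rewrite XA !trmx_mul trmxK GT mulmxA.
Qed.

Lemma penrose_ex (R : realType) (m n : nat) (A : 'M[R]_(m, n)) :
  exists X, penrose A X.
Proof.
have Cfree : row_free (col_base A)^T.
  by rewrite /row_free mxrank_tr; exact: col_base_full.
have := penrose_rank_factorization Cfree (row_base_free A).
by rewrite mulmx_base; set X := (X in penrose _ X) => AX; exists X.
Qed.

Lemma penrose_uniq (R : realType) (m n : nat) (A : 'M[R]_(m, n))
    (X Y : 'M[R]_(n, m)) : penrose A X -> penrose A Y -> X = Y.
Proof.
move=> [X1 X2 X3 X4] [Y1 Y2 Y3 Y4].
have AXY : A *m X = A *m Y.
  have e : A *m X = A *m Y *m (A *m X) by rewrite mulmxA Y1.
  by rewrite -X3 e trmx_mul X3 Y3 mulmxA X1.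
have XAY : X *m A = Y *m A.
  have e : X *m A = X *m A *m (Y *m A) by rewrite -mulmxA (mulmxA A) Y1.
  by rewrite -X4 e trmx_mul X4 Y4 -mulmxA (mulmxA A) X1.
by rewrite -X2 XAY -mulmxA AXY mulmxA Y2.
Qed.

Lemma mpinvP (R : realType) (m n : nat) (A : 'M[R]_(m, n)) :
  penrose A (mpinv A).
Proof. by have [X AX] := penrose_ex A; exact: (xgetI 0 AX). Qed.

Definition least_norm_solution (R : realType) (m n : nat)
    (A : 'M[R]_(m, n)) (b : 'cV[R]_m) (x : 'cV[R]_n) : Prop :=
  A *m x = b /\ forall y : 'cV[R]_n, A *m y = b -> norm2 x <= norm2 y.

Definition kaczmarz_step (R : realType) (m n : nat)
    (A : 'M[R]_(m, n)) (b : 'cV[R]_m) (x : 'cV[R]_n) (i : 'I_m) : 'cV[R]_n :=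
  let a := (row i A)^T in
  x - ((dot a x - b i 0) / norm2 a ^+ 2) *: a.

(* One epoch: [enum 'I_m] lists the positions in increasing order, and the row
   used at position [i] is [s i]. *)
Definition kaczmarz_epoch (R : realType) (m n : nat)
    (A : 'M[R]_(m, n)) (b : 'cV[R]_m) (s : 'S_m) (x : 'cV[R]_n) : 'cV[R]_n :=
  foldl (fun y i => kaczmarz_step A b y (s i)) x (enum 'I_m).

(* [p k] is the realization of the random permutation drawn at epoch [k]. *)
Fixpoint rrk (R : realType) (m n : nat) (A : 'M[R]_(m, n)) (b : 'cV[R]_m)
    (p : nat -> 'S_m) (x0 : 'cV[R]_n) (k : nat) : 'cV[R]_n :=
  if k is k'.+1 then kaczmarz_epoch A b (p k') (rrk A b p x0 k') else x0.

(* Main.v *)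
Require Import Defs.
From mathcomp Require Import all_boot all_order all_algebra all_fingroup.
From mathcomp Require Import all_classical all_reals all_analysis.
From mathcomp Require Import ring lra.
Import Order.TTheory GRing.Theory Num.Theory.
Import numFieldNormedType.Exports.
Local Open Scope classical_set_scope.
Local Open Scope ring_scope.

(** The pseudoinverse [X] of [A] makes [X *m A] the orthogonal projection onto
    the row space of [A].  Hence it fixes [x0], which gives the first claim, and
    every solution of the system is the sum of [X *m b] and of a vector
    orthogonal to it; Pythagoras then gives minimality and uniqueness.

    For the convergence, the errors [e_k], the differences of the iterates and
    [X *m b], are themselves the iterates of the method for the system with
    right-hand side 0, whose steps are the orthogonal projections onto the
    hyperplanes orthogonal to the rows ([rrk_sub]).  Projections do not increase the norm,
    so [dot e_k e_k] decreases to a limit, and its decrements tend to 0.  The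
    decrement over an epoch controls every row: if a sweep of projections
    removes little of the norm then it moves the vector only little, so each
    projection, when its turn comes, still acts almost on the initial vector,
    which is therefore almost orthogonal to the row ([dot_row_sweep0]).  The
    constant there does not depend on the order of the rows, so the permutations
    may change from epoch to epoch.  Hence [A *m e_k] tends to 0.  Finally, the
    errors stay in the row space, where [e_k] is [X *m (A *m e_k)], so they tend
    to 0 too. *)

(** * The dot product *)

Section DotProduct.
Context {R : realType} {n : nat}.
Implicit Types (u v w : 'cV[R]_n) (c : R).

Lemma dotC u v : dot u v = dot v u.
Proof. by apply: eq_bigr => j _; rewrite mulrC. Qed.

Lemma dotDr u v w : dot u (v + w) = dot u v + dot u w.
Proof. by rewrite -big_split; apply: eq_bigr => j _; rewrite !mxE mulrDr. Qed.

Lemma dotZr c u v : dot u (c *: v) = c * dot u v.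
Proof. by rewrite big_distrr; apply: eq_bigr => j _; rewrite !mxE mulrCA. Qed.

Lemma dotNr u v : dot u (- v) = - dot u v.
Proof. by rewrite -scaleN1r dotZr mulN1r. Qed.

Lemma dot_pythagoras u v :
  dot u v = 0 -> dot (u + v) (u + v) = dot u u + dot v v.
Proof.
move=> uv; rewrite dotDr !(dotC (u + v)) !dotDr (dotC v u) uv.
by rewrite addr0 add0r.
Qed.

Lemma dot_ge0 u : 0 <= dot u u.
Proof. by apply: sumr_ge0 => j _; rewrite -expr2 sqr_ge0. Qed.

Lemma dot_eq0 u : (dot u u == 0) = (u == 0).
Proof.
apply/idP/eqP => [|->]; last by rewrite /dot big1 // => j _; rewrite mxE mul0r.
rewrite psumr_eq0 => [/allP u0|j _]; last by rewrite -expr2 sqr_ge0.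
apply/colP => j; have := u0 j; rewrite mem_index_enum mulf_eq0 orbb mxE.
by move=> /(_ isT)/eqP.
Qed.

Lemma dot_trmx u v : dot u v = (u^T *m v) 0 0.
Proof. by rewrite mxE; apply: eq_bigr => j _; rewrite mxE. Qed.

Lemma norm2_sqr u : norm2 u ^+ 2 = dot u u.
Proof. by rewrite sqr_sqrtr// dot_ge0. Qed.

Lemma dot_le_norm2 u v : (norm2 u <= norm2 v) = (dot u u <= dot v v).
Proof. by rewrite /norm2 ler_sqrt// dot_ge0. Qed.

End DotProduct.

(** The vector [w] below is the component of [u] orthogonal to [v], scaled by
    [dot v v] to avoid a division; the inequality says that its square norm is
    nonnegative. *)
Lemma cauchy_schwarz {R : realType} {n : nat} (u v : 'cV[R]_n) :
  dot u v ^+ 2 <= dot u u * dot v v.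
Proof.
have [->|v_neq0] := eqVneq v 0.
  by rewrite -(scale0r (0 : 'cV[R]_n)) !dotZr !mul0r mulr0 expr0n.
have v_gt0 : 0 < dot v v by rewrite lt_def dot_eq0 v_neq0 dot_ge0.
have := dot_ge0 (dot v v *: u - dot u v *: v); set w := _ - _ => w_ge0.
have wE : dot w w = dot v v * (dot u u * dot v v - dot u v ^+ 2).
  rewrite [in LHS]/w dotDr dotNr !dotZr !(dotC w) /w !dotDr !dotNr !dotZr.
  by rewrite (dotC v u); ring.
by rewrite -subr_ge0 -(pmulr_rge0 _ v_gt0) -wE.
Qed.

Lemma mulmx_row {R : realType} {m n : nat} (A : 'M[R]_(m, n)) (e : 'cV[R]_n) i :
  (A *m e) i 0 = dot (row i A)^T e.
Proof. by rewrite mxE; apply: eq_bigr => j _; rewrite !mxE. Qed.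

(** * The least-norm solution *)

Section LeastNorm.
Context {R : realType} {m n : nat} (A : 'M[R]_(m, n)).
Let X := mpinv A.

Lemma mpinv_row_space (y : 'cV[R]_m) : X *m A *m (A^T *m y) = A^T *m y.
Proof.
have [AXA _ _ XA] := mpinvP A.
by rewrite mulmxA -XA -trmx_mul mulmxA AXA.
Qed.

Lemma mpinv_solution {b : 'cV[R]_m} :
  (exists x, A *m x = b) -> A *m (X *m b) = b.
Proof. by have [AXA _ _ _] := mpinvP A; case=> x <-; rewrite !mulmxA AXA. Qed.

(** The vectors [X *m b] and [z - X *m b] are orthogonal, since they are the
    images of [z] under complementary orthogonal projections. *)
Lemma mpinv_pythagoras {b : 'cV[R]_m} {z : 'cV[R]_n} : A *m z = b ->
  dot z z = dot (X *m b) (X *m b) + dot (z - X *m b) (z - X *m b).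
Proof.
move=> Az; have [_ XAX _ XA] := mpinvP A.
set u := X *m b; set w := z - u.
have uw : dot u w = 0.
  have uE : u = X *m A *m z by rewrite -mulmxA Az.
  rewrite dot_trmx {1}uE trmx_mul XA -mulmxA /w mulmxBr /u mulmxA XAX -/u.
  by rewrite -uE subrr mulmx0 mxE.
have -> : z = u + w by rewrite /w addrC subrK.
exact: dot_pythagoras.
Qed.

Lemma mpinv_least_norm (b : 'cV[R]_m) :
  (exists x, A *m x = b) -> least_norm_solution A b (X *m b).
Proof.
move=> cons; split=> [|y Ay]; first exact: mpinv_solution.
by rewrite dot_le_norm2 (mpinv_pythagoras Ay) lerDl dot_ge0.
Qed.

Lemma least_norm_uniq (b : 'cV[R]_m) (z : 'cV[R]_n) :
  (exists x, A *m x = b) -> least_norm_solution A b z -> z = X *m b.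
Proof.
move=> cons [Az]; move/(_ _ (mpinv_solution cons)).
rewrite dot_le_norm2 (mpinv_pythagoras Az) gerDl => w_le0.
by apply/eqP; rewrite -subr_eq0 -dot_eq0 eq_le w_le0 dot_ge0.
Qed.

End LeastNorm.

(** * Limits *)

Lemma sqr_cvg0 {R : realType} (u : nat -> R) :
  u k ^+ 2 @[k --> \oo] --> (0 : R) -> u k @[k --> \oo] --> (0 : R).
Proof.
move=> u2; apply/norm_cvg0P.
have : Num.sqrt (u k ^+ 2) @[k --> \oo] --> Num.sqrt (0 : R).
  by apply: continuous_cvg => //; exact: sqrt_continuous.
by rewrite sqrtr0; under eq_cvg do rewrite sqrtr_sqr.
Qed.

Lemma cvg_mx {R : realType} {m n : nat} (f : nat -> 'M[R]_(m, n))
    (M : 'M[R]_(m, n)) :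
  (forall i j, f k i j @[k --> \oo] --> M i j) -> f k @[k --> \oo] --> M.
Proof.
move=> fM B [P nbhsP PB]; rewrite /= in PB *.
have : \forall k \near \oo, forall i j, P i j (f k i j).
  by apply: filter_forall => i; apply: filter_forall => j; exact/fM/nbhsP.
by apply: filterS => k Pk; exact: PB.
Qed.

(** * The error recursion *)

Section Errors.
Context {R : realType} {m n : nat} (A : 'M[R]_(m, n)).
Let X := mpinv A.
Local Notation step0 := (kaczmarz_step A 0).

Lemma step0E e i :
  step0 e i = e - (dot (row i A)^T e / dot (row i A)^T (row i A)^T) *:
    (row i A)^T.
Proof.
by rewrite /kaczmarz_step norm2_sqr [(0 : 'cV[R]_m) _ _]mxE subr0.
Qed.

Section Shift.
Context {b : 'cV[R]_m} {z : 'cV[R]_n} (Az : A *m z = b).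

Lemma kaczmarz_step_sub x i :
  kaczmarz_step A b x i - z = step0 (x - z) i.
Proof.
rewrite step0E -norm2_sqr /kaczmarz_step dotDr dotNr -(mulmx_row A z) Az.
by rewrite addrAC.
Qed.

(** Every solution [z] can serve as the origin: row [i] of the system then reads
    [dot (row i A)^T e = 0] for the error [e]. *)
Lemma rrk_sub p x k : rrk A b p x k - z = rrk A 0 p (x - z) k.
Proof.
elim: k => //= k <-; rewrite /kaczmarz_epoch.
elim: (enum _) (rrk A b p x k) => //= i s IHs y.
by rewrite IHs kaczmarz_step_sub.
Qed.

End Shift.

Lemma step0_fixed e i : X *m A *m e = e -> X *m A *m step0 e i = step0 e i.
Proof.
move=> fe; rewrite step0E mulmxBr fe -scalemxAr; congr (_ - _ *: _).
by rewrite rowE trmx_mul mpinv_row_space.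
Qed.

(** A step adds a multiple of a row, so the errors never leave the row space,
    the set of fixed points of [X *m A]. *)
Lemma rrk0_fixed p e k :
  X *m A *m e = e -> X *m A *m rrk A 0 p e k = rrk A 0 p e k.
Proof.
move=> fe; elim: k => //= k; rewrite /kaczmarz_epoch.
elim: (enum _) (rrk A 0 p e k) => //= i s IHs y fy.
by apply: IHs; exact: step0_fixed.
Qed.

(** * Loss of norm over a sweep *)

Section Sweep.
Context (A_rows : forall i, row i A != 0).

Lemma dot_row_step0 e i : dot (row i A)^T (step0 e i) = 0.
Proof.
rewrite step0E dotDr dotNr dotZr divfK ?subrr//.
by rewrite dot_eq0 trmx_eq0.
Qed.

Lemma step0_pythagoras e i :
  dot e e = dot (step0 e i) (step0 e i) + dot (e - step0 e i) (e - step0 e i).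
Proof.
set f := step0 e i; set g := e - f.
have gf : dot f g = 0.
  rewrite /g {2}/f step0E opprB addrC subrK dotZr (dotC f) dot_row_step0.
  by rewrite mulr0.
have -> : e = f + g by rewrite addrC subrK.
exact: dot_pythagoras.
Qed.

Lemma sweep0_le s e : dot (foldl step0 e s) (foldl step0 e s) <= dot e e.
Proof.
elim: s e => //= j s IHs e; apply: le_trans (IHs _) _.
by rewrite [leRHS](step0_pythagoras e j) lerDl dot_ge0.
Qed.

(** Write [e] as the result of the first step plus the displacement: the
    displacement is paid for by the loss of norm of that step, and the result is
    either orthogonal to the row or handled by the rest of the sweep.  The
    factor 2 per step comes from [(x + y) ^+ 2 <= 2 * x ^+ 2 + 2 * y ^+ 2]. *)
Lemma dot_row_sweep0 s e i : i \in s ->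
  dot (row i A)^T e ^+ 2 <= 2 ^+ size s * dot (row i A)^T (row i A)^T *
    (dot e e - dot (foldl step0 e s) (foldl step0 e s)).
Proof.
elim: s e => //= j s IHs e; rewrite inE.
set f := step0 e j; set e' := foldl _ _ _; set a := (row i A)^T => js.
have fe' : dot e' e' <= dot f f by exact: sweep0_le.
have af : dot a f ^+ 2 <= 2 ^+ size s * dot a a * (dot f f - dot e' e').
  case/predU1P: js => [ij|]; last exact: IHs.
  rewrite /a /f ij dot_row_step0 expr0n/=.
  by rewrite !mulr_ge0 ?exprn_ge0 ?dot_ge0 ?subr_ge0.
have ag : dot a (e - f) ^+ 2 <= dot a a * (dot e e - dot f f).
  by rewrite [dot e e](step0_pythagoras e j) addrAC subrr add0r cauchy_schwarz.
have ag' : dot a a * (dot e e - dot f f) <=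
    2 ^+ size s * dot a a * (dot e e - dot f f).
  rewrite -mulrA ler_peMl ?exprn_ege1 ?ler1n//.
  by apply: le_trans ag; rewrite sqr_ge0.
have -> : dot a e = dot a f + dot a (e - f) by rewrite -dotDr addrC subrK.
rewrite (exprS 2) -(mulrA 2).
(* After the exact displacement bound [ag] is weakened to the common constant
   [K], what remains is the inequality for squares of sums. *)
move: af (le_trans ag ag') (sqr_ge0 (dot a f - dot a (e - f))).
move: (_ * dot a a) (dot a f) (dot a (e - f)) => K x y.
move: (dot e e) (dot f f) (dot e' e') => De Df De'; nra.
Qed.

Lemma epoch0E (s : 'S_m) e :
  kaczmarz_epoch A 0 s e = foldl step0 e [seq s i | i <- enum 'I_m].
Proof.
by rewrite /kaczmarz_epoch; elim: (enum _) e => //= i t IHt e; rewrite IHt.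
Qed.

Lemma epoch0_le (s : 'S_m) e :
  dot (kaczmarz_epoch A 0 s e) (kaczmarz_epoch A 0 s e) <= dot e e.
Proof. by rewrite epoch0E sweep0_le. Qed.

(** An epoch visits every row whatever the permutation, and always makes [m]
    steps, hence a constant independent of [s]. *)
Lemma dot_row_epoch0 (s : 'S_m) e i :
  dot (row i A)^T e ^+ 2 <= 2 ^+ m * dot (row i A)^T (row i A)^T *
    (dot e e - dot (kaczmarz_epoch A 0 s e) (kaczmarz_epoch A 0 s e)).
Proof.
have := @dot_row_sweep0 [seq s j | j <- enum 'I_m] e i.
rewrite size_map size_enum_ord -epoch0E; apply.
by apply/mapP; exists ((s^-1)%g i); rewrite ?mem_enum ?permKV.
Qed.

(** * Convergence *)

Lemma rrk0_row_cvg p e i :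
  (A *m rrk A 0 p e k) i 0 @[k --> \oo] --> (0 : R).
Proof.
set d := fun k => dot (rrk A 0 p e k) (rrk A 0 p e k).
have d_cvg : cvgn d.
  apply: nonincreasing_is_cvgn.
    by apply/nonincreasing_seqP => k; exact: epoch0_le.
  by exists 0 => _ [k _ <-]; exact: dot_ge0.
have loss_cvg : d k - d k.+1 @[k --> \oo] --> (0 : R).
  rewrite -(subrr (limn d)); apply: cvgB => //.
  by rewrite (cvg_shiftS d).
apply: sqr_cvg0; pose C := 2 ^+ m * dot (row i A)^T (row i A)^T.
apply: (@squeeze_cvgr _ _ _ _ (fun=> 0) (fun k => C * (d k - d k.+1))).
- apply: nearW => k; rewrite sqr_ge0 mulmx_row; exact: dot_row_epoch0.
- exact: cvg_cst.
- by rewrite -(mulr0 C); apply: cvgM => //; exact: cvg_cst.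
Qed.

End Sweep.
End Errors.

(** On the row space [e] is recovered from [A *m e] through a fixed matrix, so
    the residuals carry the errors to 0 with them. *)
Lemma rrk0_cvg {R : realType} {m n : nat} (A : 'M[R]_(m, n)) p e j :
  (forall i, row i A != 0) -> mpinv A *m A *m e = e ->
  rrk A 0 p e k j 0 @[k --> \oo] --> (0 : R).
Proof.
move=> A_rows fe.
have -> : (fun k => rrk A 0 p e k j 0) =
    (fun k => \sum_i mpinv A j i * (A *m rrk A 0 p e k) i 0).
  by apply/funext => k; rewrite -[in LHS](rrk0_fixed A p e k fe) -mulmxA mxE.
have term_cvg i : xpredT i ->
    mpinv A j i * (A *m rrk A 0 p e k) i 0 @[k --> \oo] --> (0 : R).
  move=> _; rewrite -(mulr0 (mpinv A j i)).
  by apply: cvgM; [exact: cvg_cst|exact: rrk0_row_cvg].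
have := cvg_big (x0 := 0) (r := index_enum 'I_m) add_continuous _ term_cvg.
by rewrite big1_eq; apply.
Qed.

Theorem mainTheorem3 (R : realType) (m n : nat)
    (A : 'M[R]_(m, n)) (b : 'cV[R]_m) (x0 : 'cV[R]_n)
    (A_rows : forall i : 'I_m, row i A != 0)
    (consistent : exists x : 'cV[R]_n, A *m x = b)
    (x0_range : exists y : 'cV[R]_m, x0 = A^T *m y) :
  let xLN : 'cV[R]_n := mpinv A *m b in
  [/\ mpinv A *m b + (1%:M - mpinv A *m A) *m x0 = xLN,
      least_norm_solution A b xLN,
      forall z : 'cV[R]_n, least_norm_solution A b z -> z = xLN
    & forall p : nat -> 'S_m, rrk A b p x0 k @[k --> \oo] --> xLN].
Proof.
move=> xLN; have x0_fixed : mpinv A *m A *m x0 = x0.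
  by case: x0_range => y ->; exact: mpinv_row_space.
split.
- by rewrite mulmxBl mul1mx x0_fixed subrr addr0.
- exact: mpinv_least_norm.
- by move=> z; exact: least_norm_uniq.
move=> p; apply: cvg_mx => j l; rewrite ord1.
have e_fixed : mpinv A *m A *m (x0 - xLN) = x0 - xLN.
  have [_ XAX _ _] := mpinvP A.
  by rewrite mulmxBr x0_fixed /xLN mulmxA XAX.
apply/subr_cvg0.
rewrite [X in X @ _](_ : _ = fun k => rrk A 0 p (x0 - xLN) k j 0).
  exact: rrk0_cvg.
by apply/funext => k; rewrite -(rrk_sub A (mpinv_solution A consistent)) !mxE.
Qed.
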